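(* Let $\mathfrak{a}$ be a constant $2\times 2$ complex matrix with $\mathfrak{a}^*=\mathfrak{a}$ and $\mathfrak{a}^2=I$, and let $A=A(t,x)$ be a $2\times 2$ complex matrix-valued function satisfying $A(t,x)^*=A(t,x)$ and $\mathfrak{a}A(t,x)=A(t,x)\mathfrak{a}$ for all $(t,x)$. Let $\mathfrak{u}=\mathfrak{u}(t,x)\in\mathbb{C}^2$ be a smooth solution of $$\mathfrak{u}_t-\mathfrak{a}\,\mathfrak{u}_x=-iA(t,x)\,\mathfrak{u}.$$ Then both $w=|\mathfrak{u}|^2$ and $w=\mathfrak{u}^\dagger\mathfrak{a}\,\mathfrak{u}$ satisfy the wave equation $$w_{tt}-w_{xx}=0.$$
   Context: Here $t$ (time) and $x\in\mathbb{R}$ (space) are real variables. For a complex matrix $M$, $M^*=\overline{M}^{\top}$. For a column vector $\mathfrak{u}=(u_1,u_2)^\top\in\mathbb{C}^2$, $\mathfrak{u}^\dagger=(\bar u_1,\bar u_2)$ is the conjugate transpose, so that $\mathfrak{u}^\dagger\mathfrak{u}=|\mathfrak{u}|^2=|u_1|^2+|u_2|^2$. *)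

(* Defs.v *)
From HB Require Import structures.
From mathcomp Require Import all_boot all_order all_algebra.
From mathcomp Require Import all_classical all_reals all_analysis.
From mathcomp Require Import complex.

Set Implicit Arguments.
Unset Strict Implicit.
Unset Printing Implicit Defensive.

Import Order.TTheory GRing.Theory Num.Theory.
Import numFieldNormedType.Exports.

Local Open Scope ring_scope.

(* Points of space-time are pairs (t, x). *)
Definition dir_t (R : realType) : R * R := (1, 0).
Definition dir_x (R : realType) : R * R := (0, 1).

(* f is of class C^k on R^2. *)
Fixpoint CkR (R : realType) (k : nat) (f : R * R -> R) : Prop :=
  continuous f /\
  if k is k'.+1 then
    [/\ forall p, derivable f p (dir_t R), forall p, derivable f p (dir_x R),
        CkR k' ('D_(dir_t R) f) & CkR k' ('D_(dir_x R) f)]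
  else True.

(* For functions with values in R[i], viewed as R^2, regularity and
   derivatives along real directions are taken on real and imaginary parts. *)
Definition CkC (R : realType) (k : nat) (f : R * R -> R[i]) : Prop :=
  CkR k (fun p => complex.Re (f p)) /\ CkR k (fun p => complex.Im (f p)).

Definition derC (R : realType) (v : R * R) (f : R * R -> R[i]) (p : R * R) :
    R[i] :=
  ('D_v (fun q => complex.Re (f q)) p +i* 'D_v (fun q => complex.Im (f q)) p)%C.

Definition smooth (R : realType) m n (u : R * R -> 'M[R[i]]_(m, n)) : Prop :=
  forall (k : nat) i j, CkC k (fun p => u p i j).

Definition derM (R : realType) m n (v : R * R) (u : R * R -> 'M[R[i]]_(m, n))
    (p : R * R) : 'M[R[i]]_(m, n) :=
  \matrix_(i, j) derC v (fun q => u q i j) p.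

(* The C^2 clause ensures that the second derivatives, given by a total
   operator, are genuine. *)
Definition solves_wave (R : realType) (w : R * R -> R[i]) : Prop :=
  CkC 2 w /\
  forall p : R * R,
    derC (dir_t R) (derC (dir_t R) w) p - derC (dir_x R) (derC (dir_x R) w) p = 0.

(* Main.v *)
Require Import Defs.
From HB Require Import structures.
From mathcomp Require Import all_boot all_order all_algebra.
From mathcomp Require Import all_classical all_reals all_analysis.
From mathcomp Require Import complex.
From mathcomp Require Import ring.

Set Implicit Arguments.
Unset Strict Implicit.
Unset Printing Implicit Defensive.

Import Order.TTheory GRing.Theory Num.Theory.
Import numFieldNormedType.Exports.

Local Open Scope ring_scope.
Local Open Scope sesquilinear_scope.

(* The equation and its adjoint give the pair of conservation laws
   |u|^2_t = (u^dagger a u)_x and (u^dagger a u)_t = |u|^2_x: the A-terms cancel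
   since A is Hermitian and commutes with a, and a^2 = 1 closes the system.
   Cross-differentiating, with the symmetry of second derivatives, yields the
   wave equation for both densities. *)

(** * Symmetry of mixed second derivatives *)

Lemma is_derive_line (R : realType) (V : normedModType R) (f : V -> R)
    (p v : V) (s : R) :
  derivable f (p + s *: v) v ->
  is_derive s 1 (fun r => f (p + r *: v)) ('D_v f (p + s *: v)).
Proof.
(* The two difference quotients are the same function of [h], so existence of the limit and its
   value transfer together. *)
have quotE : (fun h : R => h^-1 *: (((fun r => f (p + r *: v)) \o shift s)
      (h *: 1) - f (p + s *: v))) =
    (fun h => h^-1 *: ((f \o shift (p + s *: v)) (h *: v) - f (p + s *: v))).
  apply/funext => h /=; congr (_ *: (f _ - _)).
  by rewrite [h *: 1]mulr1 scalerDl addrCA.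
by move=> fv; apply: DeriveDef; rewrite /derivable /derive quotE.
Qed.

Lemma is_derive_translate (R : realType) (V : normedModType R) (f : V -> R)
    (p v w : V) :
  derivable f (p + w) v ->
  is_derive p v (fun q => f (q + w)) ('D_v f (p + w)).
Proof.
have quotE : (fun h : R => h^-1 *: (((fun q => f (q + w)) \o shift p)
      (h *: v) - f (p + w))) =
    (fun h => h^-1 *: ((f \o shift (p + w)) (h *: v) - f (p + w))).
  by apply/funext => h /=; rewrite addrA.
by move=> fv; apply: DeriveDef; rewrite /derivable /derive quotE.
Qed.

Lemma MVT_line (R : realType) (V : normedModType R) (f : V -> R) (p v : V)
    (h : R) :
  0 < h -> (forall q, derivable f q v) ->
  exists2 c, 0 < c < h & f (p + h *: v) - f p = h * 'D_v f (p + c *: v).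
Proof.
move=> h0 fv.
have [||c] := @MVT R (fun r => f (p + r *: v)) (fun r => 'D_v f (p + r *: v))
    0 h h0.
- by move=> x _; apply: is_derive_line.
- apply: continuous_subspaceT => x; apply: differentiable_continuous.
  by apply/derivable1_diffP; case: (is_derive_line (fv (p + x *: v))).
by rewrite in_itv /= scale0r addr0 subr0 mulrC => ch ->; exists c.
Qed.

(** Two applications of the mean value theorem: along [u] to the increment [phi] of [f] by [h *: v],
    then along [v] to ['D_u f], whose increment is the derivative of [phi]. *)
Lemma rectangle_mixed_derivative (R : realType) (V : normedModType R)
    (f : V -> R) (p u v : V) (h : R) :
  0 < h -> (forall q, derivable f q u) ->
  (forall q, derivable ('D_u f) q v) ->
  exists c d, [/\ 0 < c < h, 0 < d < h &
    f (p + h *: u + h *: v) - f (p + h *: u) - f (p + h *: v) + f p =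
    h ^+ 2 * 'D_v ('D_u f) (p + c *: u + d *: v)].
Proof.
move=> h0 fu fuv; pose phi := (fun q => f (q + h *: v)) - f.
have dphi q : is_derive q u phi ('D_u f (q + h *: v) - 'D_u f q).
  apply: is_deriveB; first exact: is_derive_translate.
  exact: derivableP.
have [c ch] := MVT_line p h0 (fun q => @ex_derive _ _ _ _ _ _ _ (dphi q)).
rewrite derive_val /phi !fctE => eq_c.
have [d dh eq_d] := MVT_line (p + c *: u) h0 fuv.
exists c, d; split => //.
by rewrite expr2 -mulrA -eq_d -eq_c opprB addrA addrAC.
Qed.

(** Passing through the common value [F q = G q'] bounds the gap at [p] by two halves of any [e].
    Two points are allowed because the mean value theorem yields different ones for the two orders
    of differentiation. *)
Lemma eq_of_near_coincidence (R : realType) (V : normedModType R)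
    (F G : V -> R) (p : V) :
  {for p, continuous F} -> {for p, continuous G} ->
  (forall r : R, 0 < r ->
    exists q q', [/\ `|p - q| < r, `|p - q'| < r & F q = G q']) ->
  F p = G p.
Proof.
move=> cF cG FG.
apply/eqP; rewrite -subr_eq0 -normr_le0; apply/ler_addgt0Pr => e e0.
rewrite add0r.
have e20 : 0 < e / 2 by rewrite divr_gt0.
have near_F := (@cvgrPdist_lt _ _ _ _ (nbhs_filter p) _ _).1 cF _ e20.
have near_G := (@cvgrPdist_lt _ _ _ _ (nbhs_filter p) _ _).1 cG _ e20.
have [r /= r0] := (nbhs_ballP _ _).1 (filterI near_F near_G).
rewrite -ball_normE => rP.
have [q [q' [qr q'r E]]] := FG r r0.
have [/ltW FqE _] := rP _ qr; have [_ /ltW Gq'E] := rP _ q'r.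
apply: (le_trans (ler_distD (F q) _ _)).
by rewrite [e]splitr (lerD FqE)// E distrC.
Qed.

(* Both iterated derivatives are limits of the same second difference of f
   over shrinking parallelograms. *)
Lemma derive_comm (R : realType) (V : normedModType R) (f : V -> R)
    (p u v : V) :
  (forall q, derivable f q u) -> (forall q, derivable f q v) ->
  (forall q, derivable ('D_u f) q v) -> (forall q, derivable ('D_v f) q u) ->
  {for p, continuous ('D_v ('D_u f))} -> {for p, continuous ('D_u ('D_v f))} ->
  'D_v ('D_u f) p = 'D_u ('D_v f) p.
Proof.
move=> fu fv fuv fvu cuv cvu.
apply: (eq_of_near_coincidence cuv cvu) => r r0.
(* With this size both parallelograms lie within [r] of [p]; the summand 1 keeps the denominator
   positive even when [u] and [v] vanish. *)
pose h := r / (`|u| + `|v| + 1).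
have D0 : 0 < `|u| + `|v| + 1 by rewrite ltr_wpDl// addr_ge0.
have h0 : 0 < h by rewrite divr_gt0.
have near_p c d : 0 < c < h -> 0 < d < h -> `|p - (p + c *: u + d *: v)| < r.
  move=> /andP[c0 ch] /andP[d0 dh].
  rewrite -addrA opprD addrA subrr add0r normrN.
  apply: (le_lt_trans (ler_normD _ _)); rewrite !normrZ !gtr0_norm//.
  have -> : r = h * `|u| + h * `|v| + h.
    by rewrite -mulrDr -[X in _ + X]mulr1 -mulrDr /h divfK// gt_eqF.
  by rewrite ltr_pwDr// lerD// ler_wpM2r// ltW.
have [c [d [ch dh E1]]] := rectangle_mixed_derivative p h0 fu fuv.
have [d' [c' [dh' ch' E2]]] := rectangle_mixed_derivative p h0 fv fvu.
exists (p + c *: u + d *: v), (p + d' *: v + c' *: u); split.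
- exact: near_p.
- by rewrite (addrAC p (d' *: v)); exact: near_p.
apply: (mulfI (_ : h ^+ 2 != 0)); first by rewrite expf_neq0// gt_eqF.
(* Exchanging [u] and [v] only permutes the terms of the second difference. *)
rewrite -[LHS]E1 -[RHS]E2 (addrAC p (h *: v)).
by rewrite -!addrA; congr (_ + _); rewrite addrCA.
Qed.

(** * Closure properties of real C^k functions *)

Lemma CkRS (R : realType) k (f : R * R -> R) : CkR k.+1 f -> CkR k f.
Proof.
elim: k f => [f [fc _]//|k IHk f [fc [ft fx Ct Cx]]].
split.
  exact: fc.
split.
- exact: ft.
- exact: fx.
- exact: (IHk _ Ct).
exact: (IHk _ Cx).
Qed.

Lemma CkR_cst (R : realType) k (c : R) : CkR k (cst c : R * R -> R).
Proof.
(* The constant stays general in the induction because the derivatives are the constant 0. *)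
elim: k c => [|k IHk] c; first by split=> // p; exact: cvg_cst.
split; first by move=> p; exact: cvg_cst.
have derc v : 'D_v (cst c : R * R -> R) = cst 0.
  by apply/funext => p; exact: derive_cst.
by split; rewrite ?derc//; move=> p; exact: derivable_cst.
Qed.

Lemma CkRD (R : realType) k (f g : R * R -> R) :
  CkR k f -> CkR k g -> CkR k (fun p => f p + g p).
Proof.
elim: k f g => [f g [fc _] [gc _]|k IHk f g].
  by split=> // p; apply: cvgD; [exact: fc|exact: gc].
move=> [fc [ft fx fCt fCx]] [gc [gt gx gCt gCx]].
split; first by move=> p; apply: cvgD; [exact: fc|exact: gc].
split.
- by move=> p; exact: derivableD (ft p) (gt p).
- by move=> p; exact: derivableD (fx p) (gx p).
(* An equality of functions is needed, since [CkR] recurses on the derivative as a function. *)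
- have -> : 'D_(dir_t R) (fun p => f p + g p) =
      (fun p => 'D_(dir_t R) f p + 'D_(dir_t R) g p).
    by apply/funext => p; exact: (deriveD (ft p) (gt p)).
  exact: (IHk _ _ fCt gCt).
- have -> : 'D_(dir_x R) (fun p => f p + g p) =
      (fun p => 'D_(dir_x R) f p + 'D_(dir_x R) g p).
    by apply/funext => p; exact: (deriveD (fx p) (gx p)).
  exact: (IHk _ _ fCx gCx).
Qed.

Lemma CkRM (R : realType) k (f g : R * R -> R) :
  CkR k f -> CkR k g -> CkR k (fun p => f p * g p).
Proof.
elim: k f g => [f g [fc _] [gc _]|k IHk f g Cf Cg].
  by split=> // p; apply: cvgM; [exact: fc|exact: gc].
move: (Cf) (Cg) => [fc [ft fx fCt fCx]] [gc [gt gx gCt gCx]].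
split; first by move=> p; apply: cvgM; [exact: fc|exact: gc].
(* The product rule pairs a derivative of class [k] with an undifferentiated factor of class [k.+1],
   which is lowered to fit the induction hypothesis. *)
have [Cf' Cg'] := (CkRS Cf, CkRS Cg).
split.
- by move=> p; exact: derivableM (ft p) (gt p).
- by move=> p; exact: derivableM (fx p) (gx p).
- have -> : 'D_(dir_t R) (fun p => f p * g p) =
      (fun p => f p * 'D_(dir_t R) g p + g p * 'D_(dir_t R) f p).
    by apply/funext => p; exact: (deriveM (ft p) (gt p)).
  exact: CkRD (IHk _ _ Cf' gCt) (IHk _ _ Cg' fCt).
- have -> : 'D_(dir_x R) (fun p => f p * g p) =
      (fun p => f p * 'D_(dir_x R) g p + g p * 'D_(dir_x R) f p).
    by apply/funext => p; exact: (deriveM (fx p) (gx p)).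
  exact: CkRD (IHk _ _ Cf' gCx) (IHk _ _ Cg' fCx).
Qed.

Lemma CkRN (R : realType) k (f : R * R -> R) :
  CkR k f -> CkR k (fun p => - f p).
Proof.
move=> Cf; have -> : (fun p => - f p) = (fun p => cst (-1) p * f p).
  by apply/funext => p; rewrite mulN1r.
by apply: CkRM => //; exact: CkR_cst.
Qed.

Lemma derive_dir_comm (R : realType) (f : R * R -> R) p : CkR 2 f ->
  'D_(dir_t R) ('D_(dir_x R) f) p = 'D_(dir_x R) ('D_(dir_t R) f) p.
Proof.
move=> [_ [ft fx [_ [_ ftx _ [ctx _]]] [_ [fxt _ [cxt _] _]]]].
exact: (derive_comm fx ft fxt ftx (cxt p) (ctx p)).
Qed.

(** * C^k regularity of complex and matrix-valued functions *)

Lemma Re_M (R : realType) (z w : R[i]) : complex.Re (z * w) =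
  complex.Re z * complex.Re w - complex.Im z * complex.Im w.
Proof. by case: z w => [? ?] []. Qed.

Lemma Im_M (R : realType) (z w : R[i]) : complex.Im (z * w) =
  complex.Re z * complex.Im w + complex.Im z * complex.Re w.
Proof. by case: z w => [? ?] []. Qed.

Lemma CkCD (R : realType) k (f g : R * R -> R[i]) :
  CkC k f -> CkC k g -> CkC k (fun p => f p + g p).
Proof.
move=> [fr fi] [gr gi]; split.
  under [X in CkR _ X]funext do rewrite raddfD; exact: CkRD.
under [X in CkR _ X]funext do rewrite raddfD; exact: CkRD.
Qed.

(** Real and imaginary parts of a product are polynomials in those of the factors. *)
Lemma CkCM (R : realType) k (f g : R * R -> R[i]) :
  CkC k f -> CkC k g -> CkC k (fun p => f p * g p).
Proof.
move=> [fr fi] [gr gi]; split.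
  under [X in CkR _ X]funext do rewrite Re_M.
  by apply: CkRD; [|apply: CkRN]; exact: CkRM.
under [X in CkR _ X]funext do rewrite Im_M.
by apply: CkRD; exact: CkRM.
Qed.

Lemma CkC_cst (R : realType) k (c : R[i]) : CkC k (fun _ : R * R => c).
Proof. by split; exact: CkR_cst. Qed.

Lemma CkC_sum (R : realType) k (I : finType) (F : I -> R * R -> R[i]) :
  (forall i, CkC k (F i)) -> CkC k (fun p => \sum_i F i p).
Proof.
move=> CF; elim: (index_enum I) => [|i s IHs].
  under [X in CkC _ X]funext do rewrite big_nil; exact: CkC_cst.
by under [X in CkC _ X]funext do rewrite big_cons; exact: CkCD.
Qed.

Lemma Re_conj (R : realType) (z : R[i]) : complex.Re z^* = complex.Re z.
Proof. by case: z. Qed.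

Lemma Im_conj (R : realType) (z : R[i]) : complex.Im z^* = - complex.Im z.
Proof. by case: z. Qed.

Lemma CkC_conj (R : realType) k (f : R * R -> R[i]) :
  CkC k f -> CkC k (fun p => (f p)^*).
Proof.
move=> [fr fi]; split.
  by under [X in CkR _ X]funext do rewrite Re_conj.
by under [X in CkR _ X]funext do rewrite Im_conj; exact: CkRN.
Qed.

Lemma CkC_mulmx (R : realType) k m n l (M : R * R -> 'M[R[i]]_(m, n))
    (N : R * R -> 'M[R[i]]_(n, l)) :
  (forall i j, CkC k (fun p => M p i j)) ->
  (forall i j, CkC k (fun p => N p i j)) ->
  forall i j, CkC k (fun p => (M p *m N p) i j).
Proof.
move=> CM CN i j; under [X in CkC _ X]funext do rewrite mxE.
by apply: CkC_sum => s; exact: CkCM.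
Qed.

Lemma CkC_adjmx (R : realType) k m n (M : R * R -> 'M[R[i]]_(m, n)) :
  (forall i j, CkC k (fun p => M p i j)) ->
  forall i j, CkC k (fun p => (M p)^t* i j).
Proof.
move=> CM i j; under [X in CkC _ X]funext do rewrite !mxE.
exact: CkC_conj.
Qed.

(** * Derivatives of complex and matrix-valued functions along real directions *)

(** Real, not complex, differentiability: conjugation must preserve it. It certifies that the total
    operator [derC] returns genuine derivatives. *)
Definition derivableC (R : realType) (f : R * R -> R[i]) (p v : R * R) : Prop :=
  derivable (fun q => complex.Re (f q)) p v /\
  derivable (fun q => complex.Im (f q)) p v.

Lemma CkC_derivable_t (R : realType) k (f : R * R -> R[i]) p :
  CkC k.+1 f -> derivableC f p (dir_t R).
Proof.
by case=> [[_ [fr _ _ _]] [_ [fi _ _ _]]]; split; [exact: fr|exact: fi].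
Qed.

Lemma CkC_derivable_x (R : realType) k (f : R * R -> R[i]) p :
  CkC k.+1 f -> derivableC f p (dir_x R).
Proof.
by case=> [[_ [_ fr _ _]] [_ [_ fi _ _]]]; split; [exact: fr|exact: fi].
Qed.

Lemma derC_cst (R : realType) (c : R[i]) (v p : R * R) :
  derC v (fun=> c) p = 0.
Proof. by rewrite /derC !derive_cst. Qed.

Lemma derivableC_cst (R : realType) (c : R[i]) (p v : R * R) :
  derivableC (fun=> c) p v.
Proof. by split; exact: derivable_cst. Qed.

Lemma derivableCD (R : realType) (f g : R * R -> R[i]) (p v : R * R) :
  derivableC f p v -> derivableC g p v ->
  derivableC (fun q => f q + g q) p v.
Proof.
move=> [fr fi] [gr gi]; split.
  by under [X in derivable X]funext do rewrite raddfD; exact: derivableD fr gr.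
by under [X in derivable X]funext do rewrite raddfD; exact: derivableD fi gi.
Qed.

Lemma derCD (R : realType) (f g : R * R -> R[i]) (v p : R * R) :
  derivableC f p v -> derivableC g p v ->
  derC v (fun q => f q + g q) p = derC v f p + derC v g p.
Proof.
move=> [fr fi] [gr gi]; rewrite /derC.
under [X in derive X]funext do rewrite raddfD.
under [X in complex.Complex _ (derive X _ _)]funext do rewrite raddfD.
by rewrite (deriveD fr gr) (deriveD fi gi).
Qed.

Lemma derivableCM (R : realType) (f g : R * R -> R[i]) (p v : R * R) :
  derivableC f p v -> derivableC g p v ->
  derivableC (fun q => f q * g q) p v.
Proof.
move=> [fr fi] [gr gi]; split.
  under [X in derivable X]funext do rewrite Re_M.
  exact: derivableB (derivableM fr gr) (derivableM fi gi).
under [X in derivable X]funext do rewrite Im_M.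
exact: derivableD (derivableM fr gi) (derivableM fi gr).
Qed.

Lemma derCM (R : realType) (f g : R * R -> R[i]) (v p : R * R) :
  derivableC f p v -> derivableC g p v ->
  derC v (fun q => f q * g q) p = derC v f p * g p + f p * derC v g p.
Proof.
move=> [fr fi] [gr gi]; rewrite /derC.
under [X in derive X]funext do rewrite Re_M.
under [X in complex.Complex _ (derive X _ _)]funext do rewrite Im_M.
rewrite (deriveB (derivableM fr gr) (derivableM fi gi)).
rewrite (deriveD (derivableM fr gi) (derivableM fi gr)).
rewrite (deriveM fr gr) (deriveM fi gi) (deriveM fr gi) (deriveM fi gr).
(* Once derivatives and values are generalised, each component is a polynomial identity over [R]. *)
move: ('D_v _ p) ('D_v _ p) ('D_v _ p) ('D_v _ p) (f p) (g p).
move=> gr' fr' gi' fi' [a b] [c d].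
have scaleE (x y : R) : x *: y = x * y by [].
by rewrite !scaleE; congr (_ +i* _)%C => /=; ring.
Qed.

(** Conjugation is linear over the reals, hence commutes with derivatives along real directions. *)
Lemma derC_conj (R : realType) (f : R * R -> R[i]) (v p : R * R) :
  derivableC f p v -> derC v (fun q => (f q)^*) p = (derC v f p)^*.
Proof.
move=> [fr fi]; rewrite /derC.
under [X in derive X]funext do rewrite Re_conj.
under [X in complex.Complex _ (derive X _ _)]funext do rewrite Im_conj.
by rewrite (deriveN fi).
Qed.

Lemma derivableC_conj (R : realType) (f : R * R -> R[i]) (p v : R * R) :
  derivableC f p v -> derivableC (fun q => (f q)^*) p v.
Proof.
move=> [fr fi]; split.
  by under [X in derivable X]funext do rewrite Re_conj; exact: fr.
by under [X in derivable X]funext do rewrite Im_conj; exact: derivableN fi.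
Qed.

Lemma derivableC_sum (R : realType) (I : Type) (s : seq I)
    (F : I -> R * R -> R[i]) (p v : R * R) :
  (forall i, derivableC (F i) p v) ->
  derivableC (fun q => \sum_(i <- s) F i q) p v.
Proof.
move=> dF; elim: s => [|i s dS].
  under [X in derivableC X]funext do rewrite big_nil; exact: derivableC_cst.
under [X in derivableC X]funext do rewrite big_cons.
exact: derivableCD (dF i) dS.
Qed.

Lemma derC_sum (R : realType) (I : Type) (s : seq I)
    (F : I -> R * R -> R[i]) (v p : R * R) :
  (forall i, derivableC (F i) p v) ->
  derC v (fun q => \sum_(i <- s) F i q) p = \sum_(i <- s) derC v (F i) p.
Proof.
move=> dF; elim: s => [|i s IHs].
  by under [X in derC _ X]funext do rewrite big_nil; rewrite big_nil derC_cst.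
under [X in derC _ X]funext do rewrite big_cons.
by rewrite big_cons (derCD (dF i) (derivableC_sum s dF)) IHs.
Qed.

Lemma derM_mulmx (R : realType) m n l (M : R * R -> 'M[R[i]]_(m, n))
    (N : R * R -> 'M[R[i]]_(n, l)) (v p : R * R) :
  (forall i j, derivableC (fun q => M q i j) p v) ->
  (forall i j, derivableC (fun q => N q i j) p v) ->
  derM v (fun q => M q *m N q) p = derM v M p *m N p + M p *m derM v N p.
Proof.
move=> dM dN; apply/matrixP => i j; rewrite !mxE -big_split /=.
under [X in derC _ X]funext do rewrite mxE.
rewrite (derC_sum _ (fun s => derivableCM (dM i s) (dN s j))).
by apply: eq_bigr => s _; rewrite derCM// !mxE.
Qed.

Lemma derM_adjmx (R : realType) m n (M : R * R -> 'M[R[i]]_(m, n))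
    (v p : R * R) :
  (forall i j, derivableC (fun q => M q i j) p v) ->
  derM v (fun q => (M q)^t*) p = (derM v M p)^t*.
Proof.
move=> dM; apply/matrixP => i j; rewrite !mxE.
under [X in derC _ X]funext do rewrite !mxE.
exact: derC_conj.
Qed.

(** * Quadratic densities, their conservation laws and the wave equation *)

Lemma derC_dir_comm (R : realType) (f : R * R -> R[i]) p : CkC 2 f ->
  derC (dir_t R) (derC (dir_x R) f) p = derC (dir_x R) (derC (dir_t R) f) p.
Proof.
by move=> [Cr Ci]; rewrite /derC /= (derive_dir_comm p Cr)
  (derive_dir_comm p Ci).
Qed.

(** The chain is f_tt = (g_x)_t = (g_t)_x = f_xx. The first-order equations are equalities of
    functions so that they can be differentiated again. *)
Lemma solves_wave_of_first_order (R : realType) (f g : R * R -> R[i]) :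
  CkC 2 f -> CkC 2 g ->
  derC (dir_t R) f = derC (dir_x R) g -> derC (dir_t R) g = derC (dir_x R) f ->
  solves_wave f.
Proof.
move=> Cf Cg ft gt; split=> // p.
by rewrite ft (derC_dir_comm p Cg) gt subrr.
Qed.

(** A single form covers both quantities: [B = 1%:M] gives the squared norm and [B = a] the other
    density. *)
Definition density (R : realType) n (B : 'M[R[i]]_n) (u : R * R -> 'cV[R[i]]_n)
    (p : R * R) : R[i] := ((u p)^t* *m B *m u p) 0 0.

Lemma CkC_density (R : realType) k n (B : 'M[R[i]]_n)
    (u : R * R -> 'cV[R[i]]_n) : smooth u -> CkC k (density B u).
Proof.
move=> Cu; apply: CkC_mulmx; last exact: Cu.
apply: CkC_mulmx; first by apply: CkC_adjmx; exact: Cu.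
by move=> i j; exact: CkC_cst.
Qed.

(** Leibniz rule for three factors, where the term differentiating the constant [B] vanishes. *)
Lemma derC_density (R : realType) n (B : 'M[R[i]]_n)
    (u : R * R -> 'cV[R[i]]_n) (v p : R * R) :
  (forall i j, derivableC (fun q => u q i j) p v) ->
  derC v (density B u) p =
  ((derM v u p)^t* *m B *m u p + (u p)^t* *m B *m derM v u p) 0 0.
Proof.
move=> du.
have duJ i j : derivableC (fun q => (u q)^t* i j) p v.
  under [X in derivableC X]funext do rewrite !mxE.
  exact: derivableC_conj.
have dB i j : derivableC (fun=> B i j) p v by exact: derivableC_cst.
have duJB i j : derivableC (fun q => ((u q)^t* *m B) i j) p v.
  under [X in derivableC X]funext do rewrite mxE.
  exact: derivableC_sum (fun s => derivableCM (duJ i s) (dB s j)).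
have derB : derM v (fun=> B) p = 0.
  by apply/matrixP => i j; rewrite !mxE derC_cst.
transitivity (derM v (fun q => (u q)^t* *m B *m u q) p 0 0).
  by rewrite mxE.
by rewrite (derM_mulmx duJB du) (derM_mulmx duJ dB) derB mulmx0 addr0
  derM_adjmx.
Qed.

Lemma adjmx_mul (R : realType) m n l (M : 'M[R[i]]_(m, n))
    (N : 'M[R[i]]_(n, l)) :
  (M *m N)^t* = N^t* *m M^t*.
Proof. by rewrite trmx_mul map_mxM. Qed.

(* The A-terms cancel because B *m A = A *m B and A is Hermitian. *)
Lemma density_conservation (R : realType) n (a B : 'M[R[i]]_n)
    (A : R * R -> 'M[R[i]]_n) (u : R * R -> 'cV[R[i]]_n) (p : R * R) :
  a^t* = a -> (A p)^t* = A p -> B *m a = a *m B -> B *m A p = A p *m B ->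
  smooth u ->
  derM (dir_t R) u p - a *m derM (dir_x R) u p = - 'i *: (A p *m u p) ->
  derC (dir_t R) (density B u) p = derC (dir_x R) (density (a *m B) u) p.
Proof.
move=> aH AH Ba BA Cu /(canRL (subrK _)) ut.
have dt i j : derivableC (fun q => u q i j) p (dir_t R).
  exact: (CkC_derivable_t p (Cu 1%N i j)).
have dx i j : derivableC (fun q => u q i j) p (dir_x R).
  exact: (CkC_derivable_x p (Cu 1%N i j)).
rewrite (derC_density B dt) (derC_density _ dx) ut.
move: (derM _ u p) (u p) => X U; congr (fun_of_matrix _ 0 0).
(* Adjoint of the equation solved for the time derivative: conjugation turns [- 'i] into ['i], and
   [a] and [A p] are Hermitian. *)
have -> : (- 'i *: (A p *m U) + a *m X)^t* = 'i *: (U^t* *m A p) + X^t* *m a.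
  rewrite linearD linearZ /= map_mxD map_mxZ !adjmx_mul aH AH.
  by rewrite rmorphN /= conjCi opprK.
rewrite mulmxDl mulmxDl mulmxDr -!scalemxAl -!scalemxAr scaleNr.
(* Moving [B] to the right of [A p] makes the two terms in [A p] opposite; moving it to the right of
   [a] gives the flux matrix [a *m B]. *)
rewrite !mulmxA -(mulmxA _ B (A p)) BA -(mulmxA _ B a) Ba !mulmxA.
by rewrite addrACA subrr add0r.
Qed.

Theorem theorem2p1 (R : realType) (a : 'M[R[i]]_2) (A : R * R -> 'M[R[i]]_2)
    (u : R * R -> 'cV[R[i]]_2)
    (a_herm : a^t* = a)
    (a_sq : a *m a = 1%:M)
    (A_herm : forall t x : R, (A (t, x))^t* = A (t, x))
    (aA_comm : forall t x : R, a *m A (t, x) = A (t, x) *m a)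
    (u_smooth : smooth u)
    (u_eq : forall t x : R,
      derM (dir_t R) u (t, x) - a *m derM (dir_x R) u (t, x) =
      - 'i *: (A (t, x) *m u (t, x))) :
  solves_wave (fun p => \sum_(i < 2) `|u p i 0| ^+ 2) /\
  solves_wave (fun p => ((u p)^t* *m a *m u p) 0 0).
Proof.
(* Entrywise, the squared modulus is the product of an entry with its conjugate. *)
have -> : (fun p => \sum_(i < 2) `|u p i 0| ^+ 2) = density 1%:M u.
  apply/funext => p; rewrite /density mulmx1 mxE; apply: eq_bigr => i _.
  by rewrite !mxE mulrC -normCK.
have C2 B : CkC 2 (density B u) by exact: CkC_density.
(* Conservation law for [B = 1%:M], which commutes with [a] and [A]. *)
have flux_a : derC (dir_t R) (density 1%:M u) = derC (dir_x R) (density a u).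
  have -> : density a u = density (a *m 1%:M) u by rewrite mulmx1.
  apply/funext => -[t x].
  by apply: density_conservation; rewrite ?mulmx1 ?mul1mx.
(* Conservation law for [B = a]: its flux matrix [a *m a] is the identity, so the flux is the first
   density again. *)
have flux_1 : derC (dir_t R) (density a u) = derC (dir_x R) (density 1%:M u).
  apply/funext => -[t x]; rewrite -a_sq.
  exact: density_conservation.
by split; [exact: solves_wave_of_first_order flux_a flux_1
  |exact: solves_wave_of_first_order flux_1 flux_a].
Qed.
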